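(* Let $R$ be a potent ring with Jacobson radical $J(R)$. Then the following six conditions are equivalent: (1) $R$ is a 2-UQ ring. (2) $R/J(R)$ is a 2-UQ ring. (3) $R/J(R)$ is a tripotent ring. (4) $R$ is a 2-UJ ring. (5) $R/J(R)$ is a 2-UJ ring. (6) $R/J(R)$ is a 2-UU ring.
   Context: Rings are associative with unity, not necessarily commutative. $U(R)$ is the set of units, $Nil(R)$ the set of nilpotent elements and $J(R)$ the Jacobson radical of $R$. An element $a\in R$ is quasi-nilpotent if $1-ax$ is invertible for every $x\in R$ with $ax=xa$; $QN(R)$ is the set of quasi-nilpotent elements. $R$ is 2-UQ if the square of each unit is the sum of an idempotent and a quasi-nilpotent element that commute with each other; equivalently, for each $u\in U(R)$, $u^2=1+q$ with $q\in QN(R)$. $R$ is 2-UJ if $u^2\in 1+J(R)$ for every $u\in U(R)$. $R$ is 2-UU if $u^2\in 1+Nil(R)$ for every $u\in U(R)$. $R$ is tripotent if $a^3=a$ for all $a\in R$. $R$ is semi-potent if every one-sided ideal not contained in $J(R)$ contains a non-zero idempotent; $R$ is potent if it is semi-potent and all idempotents lift modulo $J(R)$. *)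

(* Defs.v *)
From HB Require Import structures.
From mathcomp Require Import all_boot all_algebra.
From mathcomp Require Import boolp classical_sets.

Set Implicit Arguments.
Unset Strict Implicit.
Unset Printing Implicit Defensive.

Import GRing.Theory.
Local Open Scope ring_scope.
Local Open Scope quotient_scope.
Local Open Scope classical_set_scope.

(* Rings are of type pzRingType: associative, unital, not necessarily
   commutative, the zero ring being allowed. *)

Section Ideals.
Variable R : pzRingType.
Implicit Types I M : set R.

Definition left_ideal I : Prop :=
  [/\ I 0, (forall x y, I x -> I y -> I (x - y)) &
      (forall r x, I x -> I (r * x))].

Definition right_ideal I : Prop :=
  [/\ I 0, (forall x y, I x -> I y -> I (x - y)) &
      (forall r x, I x -> I (x * r))].

Definition maximal_left_ideal M : Prop :=
  [/\ left_ideal M, M <> setT &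
      (forall I, left_ideal I -> M `<=` I -> I = M \/ I = setT)].

Definition jacobson : set R :=
  [set x | forall M, maximal_left_ideal M -> M x].

Lemma jacobson_left_ideal : left_ideal jacobson.
Proof.
split=> [M [[]]//|x y Jx Jy M maxM|r x Jx M maxM];
  have [[_ MB MM] _ _] := maxM.
- by apply: MB; [apply: Jx | apply: Jy].
- by apply: MM; apply: Jx.
Qed.

(* If r is not in the maximal left ideal M, then {x | x * r \in M} is again a
   maximal left ideal. *)
Lemma maximal_left_ideal_colon M r : maximal_left_ideal M -> ~ M r ->
  maximal_left_ideal [set x | M (x * r)].
Proof.
move=> [[M0 MB MM] MT Mmax] nMr; split.
- split=> [|x y /= Mx My|s x /= Mx].
  + by rewrite /= mul0r.
  + by rewrite mulrBl; apply: MB.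
  + by rewrite -mulrA; apply: MM.
- by move=> eqT; apply: nMr; rewrite -[r]mul1r -[M _]/([set x | M (x * r)] 1) eqT.
move=> I [I0 IB IM] subI; have [IsubM|] := pselect (I `<=` [set x | M (x * r)]).
  by left; apply/seteqP.
move=> /existsNP[n /not_implyP[In nMnr]]; right; apply/seteqP; split=> // y _.
pose K := [set z : R | exists s, M (z - s * (n * r))].
have KI : left_ideal K.
  split=> [|x z [s Ms] [t Mt]|t x [s Ms]].
  - by exists 0; rewrite mul0r subrr.
  - exists (s - t); have := MB _ _ Ms Mt.
    by rewrite mulrBl !opprD !opprK !addrA [x - _ - z]addrAC.
  - by exists (t * s); rewrite -mulrA -mulrBr; apply: MM.
have subK : M `<=` K by move=> x Mx; exists 0; rewrite mul0r subr0.
case: (Mmax K KI subK) => [KM|KT].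
  case: nMnr; rewrite /= -KM.
  by exists 1; rewrite mul1r subrr.
have [s] : K (y * r) by rewrite KT.
rewrite mulrA -mulrBl => /subI Iysn.
have := IB _ _ Iysn (IB _ _ I0 (IM s n In)).
by rewrite sub0r opprK subrK.
Qed.

Lemma jacobson_right_ideal : right_ideal jacobson.
Proof.
have [J0 JB JM] := jacobson_left_ideal; split=> // r x Jx M maxM.
have [Mr|nMr] := pselect (M r); first by case: maxM => [[_ _ MM] _ _]; apply: MM.
exact: Jx (maximal_left_ideal_colon maxM nMr).
Qed.

Definition jacobsonb : {pred R} := fun x => `[< jacobson x >].

Lemma jacobsonb_zmod_closed : zmod_closed jacobsonb.
Proof.
have [J0 JB _] := jacobson_left_ideal.
by split=> [|x y /asboolP Jx /asboolP Jy]; apply/asboolP=> //; apply: JB.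
Qed.

HB.instance Definition _ :=
  GRing.isZmodClosed.Build R jacobsonb jacobsonb_zmod_closed.

End Ideals.

(* The quotient ring R / J(R).  The additive structure is the library's
   quotient of a Z-module by a subgroup; the library only multiplies cosets
   over commutative rings. *)
Definition jacobson_quot (R : pzRingType) := Quotient.quot (@jacobsonb R).

Section JacobsonQuotient.
Variable R : pzRingType.
Local Notation Q := (jacobson_quot R).

HB.instance Definition _ := Choice.on Q.
HB.instance Definition _ := GRing.Zmodule.on Q.
HB.instance Definition _ : EqQuotient R _ Q := EqQuotient.on Q.
HB.instance Definition _ := ZmodQuotient.on Q.

Lemma jacobson_quot_eqP (x y : R) : \pi_Q x = \pi_Q y <-> jacobson (x - y).
Proof.
split=> [/eqP|Jxy]; last apply/eqP.
  by rewrite -[_ == _]Quotient.idealrBE => /asboolP.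
by rewrite -[_ == _]Quotient.idealrBE; apply/asboolP.
Qed.

Definition jacobson_quot_one : Q := \pi_Q 1.
Definition jacobson_quot_mul (a b : Q) : Q := \pi_Q (repr a * repr b).

Lemma pi_jacobson_quot_mul (x y : R) :
  \pi_Q (x * y) = jacobson_quot_mul (\pi_Q x) (\pi_Q y).
Proof.
have [_ JB JMl] := jacobson_left_ideal R.
have [J0 _ JMr] := jacobson_right_ideal R.
have Jrepr (z : R) : jacobson (z - repr (\pi_Q z)).
  by apply/jacobson_quot_eqP; rewrite reprK.
apply/jacobson_quot_eqP.
have := JB _ _ (JMr y _ (Jrepr x))
  (JB _ _ J0 (JMl (repr (\pi_Q x)) _ (Jrepr y))).
by rewrite sub0r opprK mulrBl mulrBr addrA subrK.
Qed.

Let piD (x y : R) : \pi_Q (x + y) = \pi_Q x + \pi_Q y.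
Proof. exact: raddfD. Qed.

Lemma jacobson_quot_mulA : associative jacobson_quot_mul.
Proof.
move=> a b c; rewrite -[a]reprK -[b]reprK -[c]reprK.
move: (repr a) (repr b) (repr c) => x y z.
rewrite -(pi_jacobson_quot_mul x y) -(pi_jacobson_quot_mul y z).
by rewrite -(pi_jacobson_quot_mul x) -(pi_jacobson_quot_mul (x * y)) mulrA.
Qed.

Lemma jacobson_quot_mul1l : left_id jacobson_quot_one jacobson_quot_mul.
Proof. by move=> a; rewrite -[a]reprK -pi_jacobson_quot_mul mul1r. Qed.

Lemma jacobson_quot_mul1r : right_id jacobson_quot_one jacobson_quot_mul.
Proof. by move=> a; rewrite -[a]reprK -pi_jacobson_quot_mul mulr1. Qed.

Lemma jacobson_quot_mulDl : left_distributive jacobson_quot_mul +%R.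
Proof.
move=> a b c; rewrite -[a]reprK -[b]reprK -[c]reprK.
by rewrite -piD -!pi_jacobson_quot_mul -piD mulrDl.
Qed.

Lemma jacobson_quot_mulDr : right_distributive jacobson_quot_mul +%R.
Proof.
move=> a b c; rewrite -[a]reprK -[b]reprK -[c]reprK.
by rewrite -piD -!pi_jacobson_quot_mul -piD mulrDr.
Qed.

HB.instance Definition _ := GRing.Zmodule_isPzRing.Build Q
  jacobson_quot_mulA jacobson_quot_mul1l jacobson_quot_mul1r
  jacobson_quot_mulDl jacobson_quot_mulDr.

Definition jacobson_proj (x : R) : Q := \pi_Q x.

Lemma jacobson_proj_zmod_morphism : zmod_morphism jacobson_proj.
Proof. by move=> x y; rewrite /jacobson_proj raddfB. Qed.

Lemma jacobson_proj_monoid_morphism : monoid_morphism jacobson_proj.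
Proof. by split=> // x y; apply: pi_jacobson_quot_mul. Qed.

HB.instance Definition _ :=
  GRing.isZmodMorphism.Build R Q jacobson_proj jacobson_proj_zmod_morphism.
HB.instance Definition _ :=
  GRing.isMonoidMorphism.Build R Q jacobson_proj jacobson_proj_monoid_morphism.

End JacobsonQuotient.

Section RingClasses.
Variable R : pzRingType.

(* The library's GRing.unit is only available on (nonzero) unitRingType's. *)
Definition units : set R := [set u | exists v, u * v = 1 /\ v * u = 1].

Definition idempotents : set R := [set e | e * e = e].

Definition nilpotents : set R := [set a | exists n : nat, a ^+ n = 0].

Definition quasi_nilpotents : set R :=
  [set a | forall x, a * x = x * a -> units (1 - a * x)].

Definition ring_2UQ : Prop :=
  forall u, units u -> exists e q,
    [/\ idempotents e, quasi_nilpotents q, e * q = q * e & u ^+ 2 = e + q].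

Definition ring_2UJ : Prop :=
  forall u, units u -> exists2 j, jacobson j & u ^+ 2 = 1 + j.

Definition ring_2UU : Prop :=
  forall u, units u -> exists2 q, nilpotents q & u ^+ 2 = 1 + q.

Definition tripotent_ring : Prop := forall a : R, a ^+ 3 = a.

Definition semi_potent_ring : Prop :=
  forall I : set R, left_ideal I \/ right_ideal I ->
    ~ (I `<=` @jacobson R) -> exists e, [/\ I e, idempotents e & e <> 0].

End RingClasses.

Definition idempotents_lift_mod_jacobson (R : pzRingType) : Prop :=
  forall f : jacobson_quot R, idempotents f ->
    exists2 e : R, idempotents e & jacobson_proj e = f.

Definition potent_ring (R : pzRingType) : Prop :=
  semi_potent_ring R /\ idempotents_lift_mod_jacobson R.

(* Main.v *)
Require Import Defs.
From HB Require Import structures.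
From mathcomp Require Import all_boot all_algebra.
From mathcomp Require Import boolp classical_sets.

Set Implicit Arguments.
Unset Strict Implicit.
Unset Printing Implicit Defensive.

Import GRing.Theory.
Local Open Scope ring_scope.
Local Open Scope classical_set_scope.

(** Everything passes through the condition that no nonzero corner [eSe]
contains a unit [u] with [u ^+ 2 - e] also a unit of [eSe].  It holds in every
2-UQ ring, and it descends from [R] to [R / J(R)] because idempotents lift.
Suppose that it holds in [S] and that every nonzero principal right ideal of
[S] contains a nonzero idempotent.  Then [S] is reduced: a nonzero element of
square zero would yield a corner containing 2x2 matrix units, where the
Fibonacci matrix [u] satisfies [u ^+ 2 - 1 = u].  Hence idempotents of [S] are
central, and a nonzero idempotent in [(a - a ^+ 3) S] would give a corner in
which [a] and [a ^+ 2 - 1] are both invertible; so [a ^+ 3 = a]. *)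

(** * Units, idempotents and quasi-nilpotent elements *)

Section Units.
Variable S : pzRingType.
Implicit Types a b e q u : S.

Lemma units_mul u v : units u -> units v -> units (u * v).
Proof.
move=> [u' [uu' u'u]] [v' [vv' v'v]]; exists (v' * u'); split.
  by rewrite mulrA -(mulrA u) vv' mulr1.
by rewrite mulrA -(mulrA v') u'u mulr1.
Qed.

Lemma idempotent_unit e : idempotents e -> units e -> e = 1.
Proof. by move=> ee [v [ev _]]; rewrite -[LHS]mulr1 -ev mulrA ee. Qed.

Lemma idempotent_compl e : idempotents e -> idempotents (1 - e).
Proof.
by rewrite /idempotents /= => ee; rewrite mulrBr mulr1 mulrBl mul1r ee subrr subr0.
Qed.

Lemma idempotent_compl_unit e : idempotents e -> units (1 - e) -> e = 0.
Proof.
move=> ee /(idempotent_unit (idempotent_compl ee)) /eqP.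
by rewrite -subr_eq0 addrAC subrr add0r oppr_eq0 => /eqP.
Qed.

Lemma units_1B_nilpotent a : nilpotents a -> units (1 - a).
Proof.
move=> [n an0]; have := subrX1 a n; rewrite an0 sub0r => /eqP.
rewrite -opprB mulNr eqr_opp => /eqP E; exists (\sum_(i < n) a ^+ i).
split=> //; rewrite [RHS]E; apply: commr_sym; apply: commr_sum => i _.
by apply: commrX; apply: commr_sym; apply: commrB => //; apply: commr1.
Qed.

Lemma nilpotents_quasi_nilpotents q : nilpotents q -> quasi_nilpotents q.
Proof.
move=> [n qn0] x qx; apply: units_1B_nilpotent; exists n.
by rewrite exprMn_comm // qn0 mul0r.
Qed.

Lemma ring_2UU_2UQ : ring_2UU S -> ring_2UQ S.
Proof.
move=> S2UU u /S2UU [q /nilpotents_quasi_nilpotents qnq ->]; exists 1, q.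
by split=> //; rewrite /idempotents /= ?mul1r ?mulr1.
Qed.

(** Since [q] commutes with [u ^+ 2], it commutes with its inverse [v]. Then
    [e = (1 - q * v) * u ^+ 2] is a unit, and an idempotent unit is [1]. *)
Lemma quasi_nilpotent_sqrB1 u : ring_2UQ S -> units u ->
  quasi_nilpotents (u ^+ 2 - 1).
Proof.
move=> S2UQ uu; have [e [q [ee qnq eq u2]]] := S2UQ u uu.
have uu2 := units_mul uu uu; rewrite -expr2 in uu2.
have [v [u2v vu2]] := uu2.
have qu2 : q * u ^+ 2 = u ^+ 2 * q by rewrite u2 mulrDr mulrDl eq.
have qv : q * v = v * q.
  by rewrite -[LHS]mul1r -vu2 -mulrA (mulrA _ q v) -qu2 -mulrA u2v mulr1.
have e1 : e = 1.
  apply: idempotent_unit => //.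
  have -> : e = (1 - q * v) * u ^+ 2.
    by rewrite mulrBl mul1r -mulrA vu2 mulr1 u2 addrK.
  exact: units_mul (qnq _ qv) uu2.
by rewrite u2 e1 addrAC subrr add0r.
Qed.

End Units.

(** * The corner condition *)

Section Corners.
Variable S : pzRingType.
Implicit Types a b e u x y : S.

(* An element [u] of [eSe] is a unit of [eSe] iff [u + (1 - e)] is a unit. *)
Definition corners_avoid_unit_sqrB1 : Prop :=
  forall e u, idempotents e -> e * u = u -> u * e = u ->
    units (u + (1 - e)) -> units (u ^+ 2 - e + (1 - e)) -> e = 0.

Lemma sqrB1_corner e u : idempotents e -> e * u = u -> u * e = u ->
  (u + (1 - e)) ^+ 2 - 1 = u ^+ 2 - e.
Proof.
move=> ee eu ue; have ff := idempotent_compl ee.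
have uf : u * (1 - e) = 0 by rewrite mulrBr mulr1 ue subrr.
have fu : (1 - e) * u = 0 by rewrite mulrBl mul1r eu subrr.
rewrite expr2 mulrDl [u * _]mulrDr [(1 - e) * _]mulrDr uf fu ff addr0 add0r.
by rewrite addrA addrAC addrK.
Qed.

(** The element [q = u ^+ 2 - e] is quasi-nilpotent, being [(u + (1 - e)) ^+ 2 - 1]. The inverse [w]
    of [q + (1 - e)] satisfies [q * w = w * q = e], so [1 - q * w = 1 - e] is a unit. *)
Lemma ring_2UQ_corners : ring_2UQ S -> corners_avoid_unit_sqrB1.
Proof.
move=> S2UQ e u ee eu ue /(quasi_nilpotent_sqrB1 S2UQ).
rewrite sqrB1_corner // => qnq [w [qw wq]].
set q := u ^+ 2 - e in qnq qw wq.
have eq : e * q = q by rewrite mulrBr expr2 mulrA eu ee.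
have qe : q * e = q by rewrite mulrBl expr2 -mulrA ue ee.
have {}qw : q * w = e.
  by rewrite -[RHS]mulr1 -qw mulrA mulrDr eq mulrBr mulr1 ee subrr addr0.
have {}wq : w * q = e.
  by rewrite -[RHS]mul1r -wq -mulrA mulrDl qe mulrBl mul1r ee subrr addr0.
apply: idempotent_compl_unit => //; rewrite -qw; apply: qnq.
by rewrite wq qw.
Qed.

Lemma corner_units e u v : idempotents e -> e * u = u -> u * e = u ->
  e * v = v -> v * e = v -> u * v = e -> v * u = e -> units (u + (1 - e)).
Proof.
move=> ee eu ue ev ve uv vu; have ff := idempotent_compl ee.
have xf x : x * e = x -> x * (1 - e) = 0 by move=> xe; rewrite mulrBr mulr1 xe subrr.
have fx x : e * x = x -> (1 - e) * x = 0 by move=> ex; rewrite mulrBl mul1r ex subrr.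
exists (v + (1 - e)); split; rewrite mulrDl [_ * (_ + _)]mulrDr [(1 - e) * _]mulrDr.
  by rewrite uv ff xf // fx // addr0 add0r addrC subrK.
by rewrite vu ff xf // fx // addr0 add0r addrC subrK.
Qed.

Hypothesis avoidS : corners_avoid_unit_sqrB1.

(** Here [v] and [w] are explicit inverses, inside the corner, of [u] and [u ^+ 2 - e]. *)
Lemma corners_avoid e u v w : idempotents e ->
  e * u = u -> u * e = u -> e * v = v -> v * e = v -> e * w = w -> w * e = w ->
  u * v = e -> v * u = e -> (u ^+ 2 - e) * w = e -> w * (u ^+ 2 - e) = e ->
  e = 0.
Proof.
move=> ee eu ue ev ve ew we uv vu qw wq.
apply: (@avoidS e u) => //; first exact: (@corner_units e u v).
apply: (@corner_units e _ w) => //.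
  by rewrite mulrBr expr2 mulrA eu ee.
by rewrite mulrBl expr2 -mulrA ue ee.
Qed.

(* [x] and [y] are the off-diagonal 2x2 matrix units, so that [u] below is the
   Fibonacci matrix, for which [u ^+ 2 = u + 1]. *)
Lemma matrix_units_eq0 x y : x * x = 0 -> y * y = 0 ->
  x * y * x = x -> y * x * y = y -> x = 0.
Proof.
move=> xx yy xyx yxy; set e := x * y; set f := y * x.
have ex : e * x = x by []. have fy : f * y = y by [].
have xe : x * e = 0 by rewrite mulrA xx mul0r.
have ey : e * y = 0 by rewrite -mulrA yy mulr0.
have ye : y * e = y by rewrite mulrA.
have xf : x * f = x by rewrite mulrA.
have fx : f * x = 0 by rewrite -mulrA xx mulr0.
have yf : y * f = 0 by rewrite mulrA yy mul0r.
have ee : e * e = e by rewrite {2}/e mulrA ex.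
have ff : f * f = f by rewrite {2}/f mulrA fy.
have ef : e * f = 0 by rewrite /f mulrA ey mul0r.
have fe : f * e = 0 by rewrite /e mulrA fx mul0r.
have xy : x * y = e by []. have yx : y * x = f by [].
pose g := e + f; pose u := e + (x + y).
have gg : g * g = g by rewrite mulrDl !mulrDr ee ef fe ff addr0 add0r.
have gu : g * u = u.
  by rewrite mulrDl !mulrDr ee ex ey fe fx fy !addr0 !add0r -addrA.
have ug : u * g = u.
  by rewrite !mulrDl !mulrDr ee ef xe xf ye yf !addr0 !add0r.
have u2 : u * u = u + g.
  rewrite !mulrDl !mulrDr ee ex ey xe xx xy ye yx yy !addr0 !add0r.
  by rewrite /u /g -!addrA [y + (e + f)]addrCA.
have gv : g * (u - g) = u - g by rewrite mulrBr gu gg.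
have vg : (u - g) * g = u - g by rewrite mulrBl ug gg.
have uv : u * (u - g) = g by rewrite mulrBr u2 ug addrAC subrr add0r.
have vu : (u - g) * u = g by rewrite mulrBl u2 gu addrAC subrr add0r.
(* As [u ^+ 2 = u + g], the element [u - g] inverts both [u] and [u ^+ 2 - g = u]. *)
have g0 : g = 0.
  by apply: (@corners_avoid g u (u - g) (u - g)) => //;
     rewrite expr2 {1}u2 addrK.
by rewrite -ex -[e]addr0 -ef -{1}ee -mulrDr -/g g0 mulr0 mul0r.
Qed.

(** * From reducedness to tripotence *)

Hypothesis principal_idempotent : forall c : S, c <> 0 ->
  exists r, idempotents (c * r) /\ c * r <> 0.

(** For an idempotent [e = a * r0] one has [a * e = 0], which makes [e * a] and [(1 - e) * r]
    off-diagonal matrix units with product [e]; the vanishing of [e * a] then forces [e = 0]. *)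
Lemma sqr0_eq0 a : a * a = 0 -> a = 0.
Proof.
move=> aa; apply: contrapT => /principal_idempotent [r0 []].
set e := a * r0 => ee /eqP /negP; apply; apply/eqP.
pose r := r0 * e.
have ar : a * r = e by rewrite mulrA.
have re : r * e = r by rewrite -mulrA ee.
have ae : a * e = 0 by rewrite mulrA aa mul0r.
have xy : e * a * ((1 - e) * r) = e.
  by rewrite mulrA mulrBr mulr1 -(mulrA e) ae mulr0 subr0 -mulrA ar ee.
have x0 : e * a = 0.
  apply: (@matrix_units_eq0 _ ((1 - e) * r)).
  - by rewrite mulrA -(mulrA e) ae mulr0 mul0r.
  - by rewrite mulrA -(mulrA (1 - e)) mulrBr mulr1 re subrr mulr0 mul0r.
  - by rewrite xy mulrA ee.
  - by rewrite -mulrA xy -mulrA re.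
by rewrite -xy x0 mul0r.
Qed.

(** Both [e * x * (1 - e)] and [(1 - e) * x * e] square to zero, so [e * x] and [x * e] both equal
    [e * x * e]. *)
Lemma idempotent_central e x : idempotents e -> e * x = x * e.
Proof.
move=> ee; have ef : e * (1 - e) = 0 by rewrite mulrBr mulr1 ee subrr.
have fe : (1 - e) * e = 0 by rewrite mulrBl mul1r ee subrr.
have : e * x * (1 - e) = 0.
  by apply: sqr0_eq0; rewrite -!mulrA (mulrA _ e) fe mul0r !mulr0.
have : (1 - e) * x * e = 0.
  by apply: sqr0_eq0; rewrite -!mulrA (mulrA e (1 - e)) ef mul0r !mulr0.
by rewrite mulrBl mul1r mulrBl mulrBr mulr1 => /subr0_eq -> /subr0_eq.
Qed.

Lemma corners_tripotent : tripotent_ring S.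
Proof.
move=> a; apply: contrapT => a3.
have [c cE] : exists c, a * (1 - a ^+ 2) = c by eexists.
have acE : c = a - a ^+ 3 by rewrite -cE mulrBr mulr1 -exprS.
have c0 : c <> 0 by rewrite acE => /eqP; rewrite subr_eq0 => /eqP /esym.
have [r0 [ee e0]] := principal_idempotent c0; apply: e0.
set e := c * r0 in ee *; have eC x : e * x = x * e by apply: idempotent_central.
pose r := r0 * e.
have re : r * e = r by rewrite -mulrA ee.
have er : e * r = r by rewrite eC.
have cr : c * r = e by rewrite mulrA.
clearbody r; clearbody e => {r0}.
(* [r * c] is idempotent, hence central, so [r * c * (c * r)] regroups to
   [(c * r) * (c * r) = e]. *)
have rc : r * c = e.
  have rcC x : r * c * x = x * (r * c).
    apply: idempotent_central.
    by rewrite /idempotents /= -mulrA (mulrA c) cr mulrA re.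
  have -> : r * c = r * c * e by rewrite -mulrA -eC mulrA re.
  by rewrite -{1}cr mulrA rcC mulrA cr -mulrA cr ee.
have cC : c * a = a * c by rewrite acE mulrBl mulrBr -exprSr -exprS.
(* The corner inverse [r] of [c] commutes with [a] because [c] does. *)
have ra : r * a = a * r.
  have -> : r * a = r * a * e by rewrite -mulrA -eC mulrA re.
  by rewrite -{1}cr mulrA -(mulrA r) -cC mulrA rc -mulrA eC -mulrA re.
have aC : a * (1 - a ^+ 2) = (1 - a ^+ 2) * a.
  by rewrite mulrBl mulrBr mulr1 mul1r -exprSr -exprS.
have rb : r * (1 - a ^+ 2) = (1 - a ^+ 2) * r.
  by rewrite mulrBl mulrBr mulr1 mul1r expr2 mulrA ra -mulrA ra mulrA.
have qE : (e * a) ^+ 2 - e = - (e * (1 - a ^+ 2)).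
  by rewrite exprMn_comm; [rewrite expr2 ee mulrBr mulr1 opprB | exact: eC].
(* The factorization [c = a * (1 - a ^+ 2)] turns the inverse [r] of [c] into inverses of [e * a]
   and of [(e * a) ^+ 2 - e]. *)
apply: (@corners_avoid e (e * a) ((1 - a ^+ 2) * r) (- (a * r))) => //.
- by rewrite mulrA ee.
- by rewrite -mulrA -eC mulrA ee.
- by rewrite -rb mulrA er.
- by rewrite -mulrA re.
- by rewrite mulrN -ra mulrA er.
- by rewrite mulNr -mulrA re.
- by rewrite -mulrA (mulrA a) cE cr ee.
- by rewrite -rb eC !mulrA -(mulrA r) -aC cE rc ee.
- by rewrite qE mulrNN -mulrA (mulrA _ a) -aC cE cr ee.
- by rewrite qE mulrNN eC -ra -!mulrA mulrA mulrA -(mulrA r) cE rc ee.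
Qed.

End Corners.

(** * Maximal left ideals and units near the radical *)

Section Jacobson.
Variable R : pzRingType.
Implicit Types x y r u : R.

Lemma left_idealD (I : set R) x y : left_ideal I -> I x -> I y -> I (x + y).
Proof.
move=> [I0 IB _] Ix Iy; have := IB _ _ Ix (IB _ _ I0 Iy).
by rewrite sub0r opprK.
Qed.

Lemma left_ideal_full (I : set R) : left_ideal I -> I 1 -> I = setT.
Proof.
by move=> [_ _ IM] I1; apply/seteqP; split=> // x _; rewrite -[x]mulr1; apply: IM.
Qed.

Lemma maximal_left_ideal_exists (I : set R) : left_ideal I -> ~ I 1 ->
  exists2 M, maximal_left_ideal M & I `<=` M.
Proof.
move=> idI I1; have [I0 IB IM] := idI.
(* The empty chain has union [set0], hence the union with [I]. *)
pose P (X : set R) := left_ideal (I `|` X) /\ ~ (I `|` X) 1.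
have [|A [[idA A1] maxA]] := @Zorn_bigcup R P.
  move=> F FP totF; split; last first.
    by case=> // -[X FX X1]; have [_] := FP X FX; apply; right.
  split=> [|x y|r x]; first by left.
  - move=> [Ix|[X FX Xx]] [Iy|[Y FY Yy]].
    + by left; apply: IB.
    + have [[_ YB _] _] := FP Y FY.
      by case: (YB x y); [left | right | left | right; exists Y].
    + have [[_ XB _] _] := FP X FX.
      by case: (XB x y); [right | left | left | right; exists X].
    + case: (totF X Y FX FY) => sub.
        have [[_ YB _] _] := FP Y FY.
        by case: (YB x y); [right; apply: sub | right | left | right; exists Y].
      have [[_ XB _] _] := FP X FX.
      by case: (XB x y); [right | right; apply: sub | left | right; exists X].
  - move=> [Ix|[X FX Xx]]; first by left; apply: IM.
    have [[_ _ XM] _] := FP X FX.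
    by case: (XM r x); [right | left | right; exists X].
exists (I `|` A); last by move=> x; left.
split=> //; first by move=> E; apply: A1; rewrite E.
move=> K idK subK; have [K1|nK1] := pselect (K 1).
  by right; apply: left_ideal_full.
left; apply/seteqP; split=> //; apply: contrapT => nsub.
have IK : I `|` K = K.
  by apply/seteqP; split=> x; [case=> // Ix; apply: subK; left | right].
case: (maxA K); last by rewrite /P IK.
split; first by move=> x Ax; apply: subK; right.
by move=> KA; apply: nsub => x /KA; right.
Qed.

(** Otherwise a maximal left ideal containing all multiples [v * (1 - x)] would contain both [1 - x]
    and [x], hence [1]. *)
Lemma jacobson_left_inv x : jacobson x -> exists v, v * (1 - x) = 1.
Proof.
move=> Jx; apply: contrapT => noinv.
pose I := [set y : R | exists v, y = v * (1 - x)].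
have idI : left_ideal I.
  split=> [|_ _ [v ->] [w ->]|r _ [v ->]].
  - by exists 0; rewrite mul0r.
  - by exists (v - w); rewrite mulrBl.
  - by exists (r * v); rewrite mulrA.
have [|M maxM IM] := maximal_left_ideal_exists idI.
  by move=> [v v1]; apply: noinv; exists v.
have [idM MT _] := maxM; apply: MT; apply: left_ideal_full => //.
rewrite -[1](subrK x); apply: left_idealD => //; last exact: Jx.
by apply: IM; exists 1; rewrite mul1r.
Qed.

(** A left inverse [v] of [1 - x] equals [1 + v * x] with [v * x] in the radical, so [v] has a left
    inverse too, which must be [1 - x]. *)
Lemma jacobson_units x : jacobson x -> units (1 - x).
Proof.
move=> Jx; have [v v1] := jacobson_left_inv Jx.
have vE : v = 1 - - (v * x).
  by rewrite opprK -[LHS](subrK (v * x)) -{1}[v]mulr1 -mulrBr v1.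
have [J0 JB JM] := jacobson_left_ideal R.
have [|w] := @jacobson_left_inv (- (v * x)).
  by rewrite -sub0r; apply: JB => //; apply: JM.
rewrite -vE => wv; have wE : w = 1 - x by rewrite -[RHS]mul1r -{1}wv -mulrA v1 mulr1.
by exists v; rewrite -{1}wE.
Qed.

(** If a maximal [M] misses [x], then [M + R x] is the whole ring, and [M] contains some unit
    [1 - r * x]. *)
Lemma jacobson_of_units x : (forall r, units (1 - r * x)) -> jacobson x.
Proof.
move=> ux M [idM MT maxM]; have [M0 MB MM] := idM; apply: contrapT => nMx.
pose K := [set z : R | exists r, M (z - r * x)].
have idK : left_ideal K.
  split=> [|y z [s Ms] [t Mt]|t y [s Ms]].
  - by exists 0; rewrite mul0r subrr.
  - exists (s - t); have := MB _ _ Ms Mt.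
    by rewrite mulrBl !opprD !opprK addrACA.
  - by exists (t * s); rewrite -mulrA -mulrBr; apply: MM.
have subK : M `<=` K by move=> y My; exists 0; rewrite mul0r subr0.
case: (maxM K idK subK) => [KM|KT].
  by apply: nMx; rewrite -KM; exists 1; rewrite mul1r subrr.
have [r Mr] : K 1 by rewrite KT.
have [v [_ v1]] := ux r; apply: MT; apply: left_ideal_full => //.
by rewrite -v1; apply: MM.
Qed.

Lemma jacobson_quasi_nilpotents : @jacobson R `<=` @quasi_nilpotents R.
Proof.
move=> j Jj x _; apply: jacobson_units.
by have [_ _ JM] := jacobson_right_ideal R; apply: JM.
Qed.

End Jacobson.

(** * Passing between the ring and its quotient *)

Section JacobsonQuotient.
Variable R : pzRingType.
Implicit Types x y r u : R.
Local Notation Q := (jacobson_quot R).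
Local Notation proj := (@jacobson_proj R).

Lemma jacobson_proj_surj (a : Q) : exists x, proj x = a.
Proof. by exists (repr a); apply: reprK. Qed.

Lemma jacobson_proj_eq0 x : proj x = 0 <-> jacobson x.
Proof.
by rewrite -(rmorph0 proj) /jacobson_proj jacobson_quot_eqP subr0.
Qed.

Lemma jacobson_proj_units u : units u -> units (proj u).
Proof. by move=> [v [uv vu]]; exists (proj v); rewrite -!rmorphM uv vu rmorph1. Qed.

(** For a lift [v] of the inverse, [u * v] and [v * u] are [1] modulo the radical, hence units; so
    [u] has a right and a left inverse. *)
Lemma units_of_proj u : units (proj u) -> units u.
Proof.
move=> [b [ub bu]]; have [v vb] := jacobson_proj_surj b; subst b.
have inv x y : proj x * proj y = 1 -> units (x * y).
  move=> xy; rewrite -[x * y](subKr 1); apply: jacobson_units.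
  by apply/jacobson_proj_eq0; rewrite rmorphB rmorphM rmorph1 xy subrr.
have [s [us _]] := inv _ _ ub; have [t [_ tu]] := inv _ _ bu.
rewrite -mulrA in us; rewrite mulrA in tu.
have E : v * s = t * v by rewrite -[LHS]mul1r -tu -mulrA us mulr1.
by exists (v * s); rewrite us E.
Qed.

Lemma jacobson_quot_jacobson (a : Q) : jacobson a -> a = 0.
Proof.
have [x <-] := jacobson_proj_surj a => Jx.
apply/jacobson_proj_eq0; apply: jacobson_of_units => r; apply: units_of_proj.
rewrite rmorphB rmorph1 rmorphM; apply: jacobson_units.
by have [_ _ JM] := jacobson_left_ideal Q; apply: JM.
Qed.

(** A nonzero idempotent of [R] stays nonzero in the quotient, since the only idempotent in the
    radical is [0]. *)
Lemma semi_potent_quot_idempotent (c : Q) : semi_potent_ring R -> c <> 0 ->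
  exists r : Q, idempotents (c * r) /\ c * r <> 0.
Proof.
have [x <-] := jacobson_proj_surj c => spR /jacobson_proj_eq0 nJx.
pose I := [set y : R | exists r, y = x * r].
have idI : right_ideal I.
  split=> [|_ _ [v ->] [w ->]|r _ [v ->]].
  - by exists 0; rewrite mulr0.
  - by exists (v - w); rewrite mulrBr.
  - by exists (v * r); rewrite mulrA.
have [|e [[r ->] ee e0]] := spR I (or_intror idI).
  by move=> subJ; apply: nJx; apply: subJ; exists 1; rewrite mulr1.
exists (proj r); rewrite -rmorphM; split.
  by rewrite /idempotents /= -rmorphM ee.
by move=> /jacobson_proj_eq0 /jacobson_units /(idempotent_compl_unit ee).
Qed.

(** Idempotents and units both lift; a lift [x] of the corner element is cut down to [e * x * e] to
    lie in the corner of [e]. *)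
Lemma corners_avoid_quot : idempotents_lift_mod_jacobson R ->
  corners_avoid_unit_sqrB1 R -> corners_avoid_unit_sqrB1 Q.
Proof.
move=> lift avoidR _ a /lift [e ee <-].
have [x <-] := jacobson_proj_surj a => ex xe ux uq.
have projE : proj (e * x * e) = proj x by rewrite !rmorphM ex xe.
rewrite (_ : e = 0) ?rmorph0 //.
apply: (avoidR e (e * x * e)) => //.
- by rewrite !mulrA ee.
- by rewrite -mulrA ee.
- by apply: units_of_proj; rewrite rmorphD rmorphB rmorph1 /= projE.
- by apply: units_of_proj; rewrite rmorphD !rmorphB rmorphXn rmorph1 /= projE.
Qed.

End JacobsonQuotient.

(** * Implications between the six conditions *)

Section TripotentQuotient.
Variable R : pzRingType.
Local Notation Q := (jacobson_quot R).

Lemma tripotent_unit_sqr (S : pzRingType) (u : S) :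
  tripotent_ring S -> units u -> u ^+ 2 = 1.
Proof.
move=> S3 [v [uv _]]; have := congr1 (fun z => z * v) (S3 u).
by rewrite /= exprSr -mulrA uv mulr1.
Qed.

Lemma tripotent_2UQ (S : pzRingType) : tripotent_ring S -> ring_2UQ S.
Proof.
move=> S3 u /(tripotent_unit_sqr S3) ->; exists 1, 0.
split; rewrite /idempotents /= ?mul1r ?mulr0 ?mul0r ?addr0 //.
by move=> x _; exists 1; rewrite mul0r subr0 mulr1.
Qed.

Lemma tripotent_quot_2UJ : tripotent_ring Q -> ring_2UJ R.
Proof.
move=> Q3 u /(@jacobson_proj_units R) /(tripotent_unit_sqr Q3) u2.
exists (u ^+ 2 - 1); last by rewrite addrC subrK.
by apply/jacobson_proj_eq0; rewrite rmorphB rmorphXn rmorph1 u2 subrr.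
Qed.

Lemma ring_2UJ_2UQ : ring_2UJ R -> ring_2UQ R.
Proof.
move=> RJ u /RJ [j /(@jacobson_quasi_nilpotents R) qnj ->]; exists 1, j.
by split=> //; rewrite /idempotents /= ?mul1r ?mulr1.
Qed.

Lemma ring_2UJ_quot : ring_2UJ R -> ring_2UJ Q.
Proof.
move=> RJ a; have [u <-] := jacobson_proj_surj a => /(@units_of_proj R) /RJ [j Jj uj].
exists 0; first by have [] := jacobson_left_ideal Q.
by rewrite -rmorphXn uj rmorphD rmorph1; congr (_ + _); apply/jacobson_proj_eq0.
Qed.

Lemma quot_2UJ_2UU : ring_2UJ Q -> ring_2UU Q.
Proof.
move=> QJ u /QJ [j /(@jacobson_quot_jacobson R) -> ->]; exists 0 => //.
by exists 1%N; rewrite expr1.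
Qed.

Lemma quot_2UQ_tripotent : semi_potent_ring R -> ring_2UQ Q -> tripotent_ring Q.
Proof.
move=> spR /ring_2UQ_corners avoidQ; apply: corners_tripotent => // c.
exact: semi_potent_quot_idempotent.
Qed.

(** The corner condition, not 2-UQ itself, is carried to the quotient: elements that commute there
    may have lifts that do not commute in [R]. *)
Lemma potent_2UQ_tripotent : potent_ring R -> ring_2UQ R -> tripotent_ring Q.
Proof.
move=> [spR lift] /ring_2UQ_corners /(corners_avoid_quot lift) avoidQ.
by apply: corners_tripotent => // c; apply: semi_potent_quot_idempotent.
Qed.

End TripotentQuotient.

Theorem theorem3p5 (R : pzRingType) (hR : potent_ring R) :
  [<-> ring_2UQ R;
       ring_2UQ (jacobson_quot R);
       tripotent_ring (jacobson_quot R);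
       ring_2UJ R;
       ring_2UJ (jacobson_quot R);
       ring_2UU (jacobson_quot R)].
Proof.
have [spR _] := hR; tfae.
- by move=> /(potent_2UQ_tripotent hR) /tripotent_2UQ.
- exact: quot_2UQ_tripotent.
- exact: tripotent_quot_2UJ.
- exact: ring_2UJ_quot.
- exact: quot_2UJ_2UU.
(* The cycle closes through tripotence of the quotient. *)
- move=> /ring_2UU_2UQ /(quot_2UQ_tripotent spR) /tripotent_quot_2UJ.
  exact: ring_2UJ_2UQ.
Qed.
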